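(* Let $p$ be an odd prime. If $p\equiv1\pmod4$, write $p=x^2+4y^2$ with integers $x,y$ and $4\mid x-1$; then $$\sum_{k=0}^{p-1}\frac{\binom{2k}k^2}{(-16)^k(2k-1)^2}\equiv(-1)^{\frac{p-1}4}\frac px\pmod{p^2}.$$ If $p\equiv3\pmod4$, then $$\sum_{k=0}^{p-1}\frac{\binom{2k}k^2}{(-16)^k(2k-1)^2}\equiv(-1)^{\frac{p+1}4}(2p+3-2^{p-1})\binom{\frac{p-1}2}{\frac{p-3}4}\pmod{p^2}$$ and $$\sum_{k=0}^{p-1}\frac{\binom{2k}k^2}{(-16)^k(2k-1)}\equiv\frac12(-1)^{\frac{p-3}4}(2p+3-2^{p-1})\binom{\frac{p-1}2}{\frac{p-3}4}-(-1)^{\frac{p-3}4}\frac{p}{\binom{(p-1)/2}{(p-3)/4}}\pmod{p^2}.$$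
   Context: Congruences are taken in the ring of rational numbers whose denominators are not divisible by $p$. *)

(* Defs.v *)
From mathcomp Require Import all_boot all_order all_algebra.

Set Implicit Arguments.
Unset Strict Implicit.
Unset Printing Implicit Defensive.

Import Order.TTheory GRing.Theory Num.Theory.
Local Open Scope ring_scope.

(* The ring Z_(p), as a subset of rat; [denq] is the reduced denominator. *)
Definition p_integral (p : nat) : {pred rat} :=
  [pred r : rat | ~~ (p %| `|denq r|)%N].

(* Congruence modulo the ideal m Z_(p); both sides must belong to Z_(p). *)
Definition congr_Zp (p m : nat) (a b : rat) : Prop :=
  [/\ a \in p_integral p, b \in p_integral p
    & exists2 c : rat, c \in p_integral p & a - b = m%:R * c].

(* Main.v *)
Require Import Defs.
From mathcomp Require Import all_boot all_order all_algebra.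
From mathcomp Require Import cyclic finfield.
From mathcomp Require Import zify ring.

Set Implicit Arguments.
Unset Strict Implicit.
Unset Printing Implicit Defensive.

Import Order.TTheory GRing.Theory Num.Theory.
Local Open Scope ring_scope.

(* Put n = (p-1)/2.  The summands are (-1)^k binom(a,k)^2 with a = 1/2, and the
   contiguous sum with a = -1/2 gives the mixed one by telescoping.  Modulo p^2
   one may replace a by the integer M = N + p n, where N = n+1 (resp. n), and
   binom(M,k) = binom(N,k) mod p makes the squares linear:
   binom(M,k)^2 = 2 binom(M,k) binom(N,k) - binom(N,k)^2 mod p^2.
   The resulting sums are coefficients of X^N in (1-X)^M (1+X)^N.  For N even,
   the same linearization lets one replace this product by (1-X^2)^M, whose
   coefficient is a single binomial.  For N odd, the factorization
   (1-X^2)^N (1-X)^(p n) yields p times a partial fraction sum evaluated in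
   closed form.  The power 2^n, needed modulo p^2 when p = 4h+3, is fixed by its
   sign modulo p, which binom(1/2,h+1) = binom(n+1,h+1) mod p determines; and
   p/x comes from Gauss's congruence binom(2h,h) = 2x mod p for p = 4h+1, proved
   with Jacobsthal sums. *)

(** * Congruences in Z_(p) *)

(** Frees the closure proofs from reduced fractions: the reduced denominator divides every
    denominator [b] of [r], so one prime to [p] suffices. *)
Lemma p_integralP (p : nat) (r : rat) :
  reflect (exists a : int, exists2 b : nat, ~~ (p %| b)%N & r = a%:~R / b%:R)
    (r \in p_integral p).
Proof.
apply: (iffP idP) => [hr|[a [b hb rE]]].
  exists (numq r), `|denq r|%N => //.
  by rewrite -[LHS]divq_num_den [in RHS]pmulrn absz_denq.
rewrite inE; apply: contra hb => hd; apply: dvdn_trans hd _.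
have [->|b0] := eqVneq b 0%N; first exact: dvdn0.
have bq0 : b%:R != 0 :> rat by rewrite pnatr_eq0.
have e : numq r * b%:Z = a * denq r.
  apply: (@intr_inj rat); rewrite !rmorphM /=.
  have h : (numq r)%:~R = r * (denq r)%:~R by rewrite numqE.
  by rewrite h rE -pmulrn mulrAC divfK.
have : (denq r %| numq r * b%:Z)%Z by rewrite e dvdz_mull.
by rewrite Gauss_dvdzr ?dvdzE // coprimezE coprime_sym coprime_num_den.
Qed.

Lemma p_integral_int (p : nat) (z : int) : prime p -> z%:~R \in p_integral p.
Proof.
move=> pp; apply/p_integralP; exists z, 1%N; last by rewrite divr1.
by rewrite dvdn1; case: p pp => [|[|]].
Qed.

Lemma p_integral_nat (p k : nat) : prime p -> k%:R \in p_integral p.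
Proof. by move=> pp; rewrite pmulrn p_integral_int. Qed.

Lemma p_integral_invn (p k : nat) : ~~ (p %| k)%N -> k%:R^-1 \in p_integral p.
Proof. by move=> hk; apply/p_integralP; exists 1, k => //; rewrite mul1r. Qed.

Lemma p_integralN (p : nat) (a : rat) :
  a \in p_integral p -> - a \in p_integral p.
Proof.
move=> /p_integralP [u [b hb ->]]; apply/p_integralP; exists (- u), b => //.
by rewrite rmorphN mulNr.
Qed.

Lemma p_integralM (p : nat) (a b : rat) : prime p ->
  a \in p_integral p -> b \in p_integral p -> a * b \in p_integral p.
Proof.
move=> pp /p_integralP [u [d hd ->]] /p_integralP [v [e he ->]].
apply/p_integralP; exists (u * v), (d * e)%N.
  by rewrite Euclid_dvdM // negb_or hd.
by rewrite rmorphM natrM mulf_div.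
Qed.

Lemma p_integralD (p : nat) (a b : rat) : prime p ->
  a \in p_integral p -> b \in p_integral p -> a + b \in p_integral p.
Proof.
move=> pp /p_integralP [u [d hd ->]] /p_integralP [v [e he ->]].
apply/p_integralP; exists (u * e%:Z + v * d%:Z), (d * e)%N.
  by rewrite Euclid_dvdM // negb_or hd.
rewrite addf_div ?rmorphD ?rmorphM ?natrM -?pmulrn //.
  by rewrite pnatr_eq0; apply: contra hd => /eqP ->.
by rewrite pnatr_eq0; apply: contra he => /eqP ->.
Qed.

Lemma p_integralX (p : nat) (a : rat) (k : nat) : prime p ->
  a \in p_integral p -> a ^+ k \in p_integral p.
Proof.
move=> pp ha; elim: k => [|k IH]; first by rewrite expr0 (p_integral_nat 1).
by rewrite exprS p_integralM.
Qed.

Lemma congr_refl (p m : nat) (a : rat) : prime p ->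
  a \in p_integral p -> congr_Zp p m a a.
Proof.
move=> pp ha; split=> //; exists 0; first exact: (p_integral_nat 0).
by rewrite subrr mulr0.
Qed.

Lemma congr_sym (p m : nat) (a b : rat) : congr_Zp p m a b -> congr_Zp p m b a.
Proof.
case=> ha hb [c hc e]; split=> //; exists (- c); first exact: p_integralN.
by rewrite mulrN -e opprB.
Qed.

Lemma congr_trans (p m : nat) (b a c : rat) : prime p ->
  congr_Zp p m a b -> congr_Zp p m b c -> congr_Zp p m a c.
Proof.
move=> pp [ha hb [d hd e]] [_ hc [d' hd' e']]; split=> //.
exists (d + d'); first exact: p_integralD.
by rewrite mulrDr -e -e' addrA subrK.
Qed.

Lemma congrD (p m : nat) (a b c d : rat) : prime p ->
  congr_Zp p m a b -> congr_Zp p m c d -> congr_Zp p m (a + c) (b + d).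
Proof.
move=> pp [ha hb [u hu e]] [hc hd [v hv e']]; split; try exact: p_integralD.
exists (u + v); first exact: p_integralD.
by rewrite mulrDr -e -e'; ring.
Qed.

Lemma congrN (p m : nat) (a b : rat) :
  congr_Zp p m a b -> congr_Zp p m (- a) (- b).
Proof.
case=> ha hb [u hu e]; split; try exact: p_integralN.
exists (- u); first exact: p_integralN.
by rewrite mulrN -e; ring.
Qed.

Lemma congrB (p m : nat) (a b c d : rat) : prime p ->
  congr_Zp p m a b -> congr_Zp p m c d -> congr_Zp p m (a - c) (b - d).
Proof. by move=> pp h h'; apply: congrD => //; apply: congrN. Qed.

Lemma congrM (p m : nat) (a b c d : rat) : prime p ->
  congr_Zp p m a b -> congr_Zp p m c d -> congr_Zp p m (a * c) (b * d).
Proof.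
move=> pp [ha hb [u hu e]] [hc hd [v hv e']]; split; try exact: p_integralM.
exists (u * c + b * v).
  by apply: p_integralD => //; apply: p_integralM.
have -> : m%:R * (u * c + b * v) = (m%:R * u) * c + b * (m%:R * v) by ring.
by rewrite -e -e'; ring.
Qed.

Lemma congrMl (p m : nat) (c a b : rat) : prime p -> c \in p_integral p ->
  congr_Zp p m a b -> congr_Zp p m (c * a) (c * b).
Proof. by move=> pp hc h; apply: congrM => //; apply: congr_refl. Qed.

Lemma congrX (p m : nat) (a b : rat) (k : nat) : prime p ->
  congr_Zp p m a b -> congr_Zp p m (a ^+ k) (b ^+ k).
Proof.
move=> pp h; elim: k => [|k IH]; last by rewrite !exprS; apply: congrM.
by rewrite !expr0; apply: congr_refl => //; apply: (p_integral_nat 1).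
Qed.

Lemma congr_sum (p m : nat) (I : eqType) (r : seq I) (P : pred I)
    (F G : I -> rat) : prime p ->
  (forall i, i \in r -> P i -> congr_Zp p m (F i) (G i)) ->
  congr_Zp p m (\sum_(i <- r | P i) F i) (\sum_(i <- r | P i) G i).
Proof.
move=> pp h; rewrite big_seq_cond [X in congr_Zp _ _ _ X]big_seq_cond.
apply: (big_ind2 (congr_Zp p m)).
- by apply: congr_refl => //; apply: (p_integral_nat 0).
- by move=> *; apply: congrD.
- by move=> i /andP [hi hP]; apply: h.
Qed.

Lemma congr_int (p m : nat) (a b : int) : prime p ->
  (m%:Z %| a - b)%Z -> congr_Zp p m a%:~R b%:~R.
Proof.
move=> pp /dvdzP [q e]; split; try exact: p_integral_int.
exists q%:~R; first exact: p_integral_int.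
by rewrite -rmorphB e rmorphM /= -pmulrn mulrC.
Qed.

(** With [k = m = p], an explicit factor p lets its cofactor be computed modulo p only while the
    whole is known modulo p^2. *)
Lemma congr_scale (p m k : nat) (a b : rat) : prime p ->
  congr_Zp p m a b -> congr_Zp p (k * m) (k%:R * a) (k%:R * b).
Proof.
move=> pp [ha hb [c hc e]].
have hk := p_integral_nat k pp; split; try exact: p_integralM.
by exists c; rewrite // natrM -mulrA -e mulrBr.
Qed.

Lemma congr_weaken (p m k : nat) (a b : rat) : prime p ->
  congr_Zp p (k * m) a b -> congr_Zp p m a b.
Proof.
move=> pp [ha hb [c hc e]]; split=> //; exists (k%:R * c).
  by apply: p_integralM => //; apply: p_integral_nat.
by rewrite e natrM; ring.
Qed.

Lemma congr_cancel (p m : nat) (u a b : rat) : prime p ->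
  u != 0 -> u^-1 \in p_integral p ->
  congr_Zp p m (u * a) (u * b) -> congr_Zp p m a b.
Proof.
by move=> pp u0 hu /(congrMl pp hu); rewrite !mulKf.
Qed.

(* Makes squares of p-congruent quantities linear modulo p^2. *)
Lemma congr_mul_sub (p : nat) (a b c d : rat) : prime p ->
  congr_Zp p p a b -> congr_Zp p p c d ->
  congr_Zp p (p ^ 2) (a * c) (a * d + b * c - b * d).
Proof.
move=> pp [ha hb [u hu e]] [hc hd [v hv e']]; split.
- exact: p_integralM.
- by apply: p_integralD; rewrite ?p_integralN ?p_integralD ?p_integralM.
- exists (u * v); first exact: p_integralM.
  have -> : a * c - (a * d + b * c - b * d) = (a - b) * (c - d) by ring.
  by rewrite e e' natrX; ring.
Qed.

(** * Coefficients of (1 - X)^M (1 + X)^N *)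

Lemma coef_exp_1DX (n k : nat) : ((1 + 'X) ^+ n : {poly rat})`_k = 'C(n, k)%:R.
Proof.
rewrite addrC exprD1n coef_sum; under eq_bigr => i _ do rewrite coefMn coefXn.
case: (ltnP k n.+1) => [hk|hk].
  rewrite (bigD1 (Ordinal hk)) //= eqxx big1 ?addr0 // => i hi.
  by case: eqP => [e|]; rewrite ?mul0rn // -val_eqE /= -e eqxx in hi *.
rewrite bin_small // big1 // => i _; case: eqP => [e|]; last by rewrite mul0rn.
by have := ltn_ord i; rewrite -e ltnNge hk.
Qed.

Lemma coef_exp_1BX (n k : nat) :
  ((1 - 'X) ^+ n : {poly rat})`_k = (-1) ^+ k * 'C(n, k)%:R.
Proof.
elim: n k => [|n IH] k.
  by rewrite expr0 coef1; case: k => [|k]; rewrite ?bin0 ?bin0n ?mulr0 ?mul1r.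
rewrite exprSr mulrBr mulr1 coefB coefMX IH.
case: k => [|k]; first by rewrite !bin0 subr0.
by rewrite IH /= binS natrD exprS; ring.
Qed.

Lemma coef_exp_1BX2 (n k : nat) : ((1 - 'X^2) ^+ n : {poly rat})`_k
  = if odd k then 0 else (-1) ^+ k./2 * 'C(n, k./2)%:R.
Proof.
elim: n k => [|n IH] k.
  rewrite expr0 coef1; case: k => [|[|k]] //=.
  by rewrite bin0n mulr0; case: ifP.
rewrite exprSr mulrBr mulr1 coefB coefMXn !IH.
case: k => [|[|k]] /=; rewrite ?subr0 ?bin0 // negbK subn2 /=.
by case: ifP => _; rewrite ?subr0 // binS natrD exprS; ring.
Qed.

Definition alt_conv (M N K : nat) : rat :=
  \sum_(k < K.+1) (-1) ^+ k * ('C(M, k)%:R * 'C(N, K - k)%:R).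

Lemma alt_conv_coef (M N K : nat) :
  alt_conv M N K = ((1 - 'X) ^+ M * (1 + 'X) ^+ N : {poly rat})`_K.
Proof.
rewrite coefM; apply: eq_bigr => k _.
by rewrite coef_exp_1BX coef_exp_1DX mulrA.
Qed.

Lemma mul_exp_1BX_1DX (N : nat) :
  (1 - 'X) ^+ N * (1 + 'X) ^+ N = (1 - 'X^2) ^+ N :> {poly rat}.
Proof. by rewrite -exprMn; congr (_ ^+ _); ring. Qed.

(* Terminating case of Kummer's summation of 2F1 at -1. *)
Lemma alt_conv_diag (N K : nat) : alt_conv N N K
  = if odd K then 0 else (-1) ^+ K./2 * 'C(N, K./2)%:R.
Proof. by rewrite alt_conv_coef mul_exp_1BX_1DX coef_exp_1BX2. Qed.

Lemma sum_even_support (h : nat) (F : nat -> rat) :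
  (forall i, odd i -> F i = 0) ->
  \sum_(j < h.*2.+2) F j = \sum_(i < h.+1) F i.*2.
Proof.
move=> F0; elim: h => [|h IH].
  by rewrite !big_ord_recr !big_ord0 /= !add0r (F0 1%N) ?addr0.
rewrite doubleS big_ord_recr big_ord_recr /= IH (F0 h.*2.+3) ?addr0; last first.
  by rewrite /= odd_double.
by rewrite [RHS]big_ord_recr.
Qed.

(** Here (1-X)^(N+L) (1+X)^N = (1-X^2)^N (1-X)^L. The first factor has only even powers X^(2i), so
    as N is odd the second is read at the odd degree N-2i, which produces the common minus sign. *)
Lemma alt_conv_shift (h L : nat) : let N := h.*2.+1 in
  alt_conv (N + L) N N
  = - \sum_(i < h.+1) (-1) ^+ i * ('C(N, i)%:R * 'C(L, N - i.*2)%:R).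
Proof.
move=> N; rewrite alt_conv_coef exprD mulrAC mul_exp_1BX_1DX coefM.
rewrite (@sum_even_support h (fun j => ((1 - 'X^2) ^+ N : {poly rat})`_j
    * ((1 - 'X) ^+ L : {poly rat})`_(N - j))); last first.
  by move=> i hi; rewrite coef_exp_1BX2 hi mul0r.
rewrite -sumrN; apply: eq_bigr => i _.
rewrite coef_exp_1BX2 odd_double doubleK coef_exp_1BX.
rewrite -[(-1) ^+ (N - _)]signr_odd oddB; last first.
  by rewrite /N leqW // leq_double -ltnS.
by rewrite /N /= !odd_double /= expr1; ring.
Qed.

(** * Partial fractions and central binomial coefficients *)

Lemma partial_fraction (N : nat) (x : rat) :
  (forall i, (i <= N)%N -> x + i%:R != 0) ->
  \sum_(i < N.+1) (-1) ^+ i * 'C(N, i)%:R / (x + i%:R)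
  = N`!%:R / \prod_(i < N.+1) (x + i%:R).
Proof.
elim: N x => [|N IH] x hx.
  by rewrite !big_ord_recr !big_ord0 /= bin0 fact0 mulr1 add0r mul1r.
have sh i : x + 1 + i%:R = x + i.+1%:R by rewrite -addrA -natr1; ring.
have IH1 := IH x (fun i hi => hx i (leqW hi)).
have IH2 : \sum_(i < N.+1) (-1) ^+ i * 'C(N, i)%:R / (x + i.+1%:R)
  = N`!%:R / \prod_(i < N.+1) (x + i.+1%:R).
  under eq_bigr => i _ do rewrite -sh.
  under [X in _ / X]eq_bigr => i _ do rewrite -sh.
  by apply: IH => i hi; rewrite sh; apply: hx.
(* By Pascal's rule the sum for N+1 at x is the sum for N at x minus the sum for N at x+1. The first
   of these is lengthened by a zero term, since binom(N, N+1) = 0. *)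
have -> : \sum_(i < N.+2) (-1) ^+ i * 'C(N.+1, i)%:R / (x + i%:R)
  = \sum_(i < N.+1) (-1) ^+ i * 'C(N, i)%:R / (x + i%:R)
    - \sum_(i < N.+1) (-1) ^+ i * 'C(N, i)%:R / (x + i.+1%:R).
  rewrite big_ord_recl /= bin0.
  rewrite [X in _ = X - _](_ : _ = \sum_(i < N.+2)
     (-1) ^+ i * 'C(N, i)%:R / (x + i%:R)); last first.
    by rewrite [RHS]big_ord_recr /= bin_small // mulr0 mul0r addr0.
  rewrite [in RHS]big_ord_recl /= bin0 -addrA; congr (_ + _).
  rewrite -sumrB; apply: eq_bigr => i _.
  by rewrite /bump leq0n add1n binS natrD exprS; ring.
set P := \prod_(i < N) (x + i.+1%:R).
have e1 : \prod_(i < N.+1) (x + i%:R) = (x + 0%:R) * P.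
  by rewrite big_ord_recl; congr (_ * _).
have e2 : \prod_(i < N.+1) (x + i.+1%:R) = P * (x + N.+1%:R).
  by rewrite big_ord_recr.
have e3 : \prod_(i < N.+2) (x + i%:R) = (x + 0%:R) * (P * (x + N.+1%:R)).
  by rewrite big_ord_recl -e2.
rewrite IH1 IH2 e1 e2 e3.
have P0 : P != 0 by apply/prodf_neq0 => i _; exact/hx/leqW/ltn_ord.
have x0 := hx 0%N (leq0n _); have xN := hx N.+1 (leqnn _).
rewrite factS natrM.
have -> : N.+1%:R = (x + N.+1%:R) - (x + 0%:R) :> rat by ring.
field; move: x0 xN; rewrite addr0 -natr1 P0 => -> xN; rewrite !andbT.
by apply: contra xN => /eqP <-; apply/eqP; ring.
Qed.

Lemma central_binS (k : nat) :
  (k.+1 * 'C(2 * k.+1, k.+1) = 2 * (2 * k).+1 * 'C(2 * k, k))%N.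
Proof.
have e1 := mul_bin_diag (2 * k.+1) k.
have e2 := mul_bin_down (2 * k).+1 k.
have -> : (2 * k.+1 = (2 * k).+2)%N by lia.
move: e1 e2; rewrite (_ : (2 * k.+1).-1 = (2 * k).+1)%N; last by lia.
rewrite (_ : (2 * k.+1 = (2 * k).+2)%N); last by lia.
rewrite (_ : ((2 * k).+1 - k = k.+1)%N); last by lia.
by rewrite /=; nia.
Qed.

Lemma central_binS_rat (k : nat) : 'C(2 * k.+1, k.+1)%:R
  = 2 * (2 * k%:R + 1) / (k%:R + 1) * 'C(2 * k, k)%:R :> rat.
Proof.
have k1 : k%:R + 1 != 0 :> rat by rewrite natr1 pnatr_eq0.
have := congr1 (fun n => n%:R : rat) (central_binS k).
rewrite !natrM -!natr1 natrM => e.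
apply: (mulfI k1); rewrite e; by field.
Qed.

(** This is [partial_fraction] at x = -N/2 with N = 2h+1. Since N is odd, i -> N-i preserves the
    summand, and the sum up to h is half of the full one. *)
Lemma half_partial_fraction (h : nat) :
  \sum_(i < h.+1) (-1) ^+ i * 'C(h.*2.+1, i)%:R / (h.*2.+1%:R - 2 * i%:R)
  = (-1) ^+ h * 16 ^+ h / (h.*2.+1%:R * 'C(2 * h, h)%:R) :> rat.
Proof.
set N := h.*2.+1; set x : rat := - (N%:R / 2).
have oddne (i : nat) : N%:R - 2 * i%:R != 0 :> rat.
  rewrite subr_eq0 -natrM eqr_nat; apply/eqP => e.
  by have := congr1 odd e; rewrite /N /= mul2n !odd_double.
have xi (i : nat) : x + i%:R = - (N%:R - 2 * i%:R) / 2 by rewrite /x; field.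
have xne i : (i <= N)%N -> x + i%:R != 0.
  by move=> _; rewrite xi mulf_neq0 ?oppr_eq0 ?oddne.
have pf := partial_fraction xne.
pose F (i : nat) : rat := (-1) ^+ i * 'C(N, i)%:R / (N%:R - 2 * i%:R).
have full : \sum_(i < N.+1) F i = 2 * \sum_(i < h.+1) F i.
  have -> : N.+1 = (h.+1 + h.+1)%N by rewrite addnn doubleS.
  rewrite big_split_ord /= mulr_natl mulr2n; congr (_ + _).
  rewrite (reindex_inj rev_ord_inj) /=; apply: eq_bigr => i _.
  have hi := ltn_ord i.
  have -> : (h.+1 + (h.+1 - i.+1) = N - i)%N by rewrite /N -addnn; lia.
  have iN : (i <= N)%N by rewrite /N -addnn; lia.
  rewrite /F bin_sub // natrB // -signr_odd oddB // /N /= odd_double /=.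
  rewrite signrN signr_odd (_ : _ - 2 * _ = - (h.*2.+1%:R - 2 * i%:R)).
    by rewrite invrN; ring.
  by ring.
(* The factors are half-integers symmetric about 0, so passing from h' to h'+1 adds one factor at
   each end of the product. *)
have P h' : \prod_(i < h'.*2.+2) (- (h'.*2.+1%:R / 2) + i%:R)
   * ((-1) ^+ h' * 16 ^+ h')
   = - (h'.*2.+1`!%:R * h'.*2.+1%:R * 'C(2 * h', h')%:R / 4) :> rat.
  elim: h' => [|k IH].
    by rewrite !big_ord_recr big_ord0 /= bin0 (_ : 1`! = 1)%N //; field.
  have -> : \prod_(i < k.+1.*2.+2) (- (k.+1.*2.+1%:R / 2) + i%:R)
    = - (k.*2.+3%:R / 2) * (\prod_(i < k.*2.+2)
        (- (k.*2.+1%:R / 2) + i%:R)) * (k.*2.+3%:R / 2) :> rat.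
    rewrite doubleS big_ord_recl big_ord_recr /= mulrA; congr (_ * _ * _).
    - by rewrite addr0.
    - by apply: eq_bigr => i _; rewrite /bump leq0n add1n -!natr1; field.
    - by rewrite /bump leq0n add1n -!natr1; field.
  have -> : k.+1.*2.+1`!%:R = k.*2.+3%:R * (k.*2.+2%:R * k.*2.+1`!%:R) :> rat.
    by rewrite -!natrM.
  rewrite !exprS central_binS_rat.
  have k1 : k%:R + 1 != 0 :> rat by rewrite natr1 pnatr_eq0.
  transitivity (- (k.*2.+3%:R / 2) * (k.*2.+3%:R / 2) * -16 *
     (\prod_(i < k.*2.+2) (- (k.*2.+1%:R / 2) + i%:R) * ((-1) ^+ k * 16 ^+ k)) : rat).
    by rewrite -!natr1 -!muln2 natrM; ring.
  rewrite IH; move: (k.*2.+1`!%:R : rat) => f.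
  rewrite -!natr1 -!muln2 natrM. field.
  by rewrite k1.
have P0 : \prod_(i < N.+1) (x + i%:R) != 0.
  by apply/prodf_neq0 => i _; apply: xne; rewrite -ltnS.
have e2 : \sum_(i < N.+1) F i
   = - (\sum_(i < N.+1) (-1) ^+ i * 'C(N, i)%:R / (x + i%:R)) / 2.
  rewrite -sumrN mulr_suml; apply: eq_bigr => i _.
  by rewrite xi /F; field.
have two : 2 != 0 :> rat by [].
apply: (mulfI two); rewrite -[LHS]full e2 pf.
have := P h; rewrite -/N -/x => PE.
have N0 : N%:R != 0 :> rat by rewrite pnatr_eq0.
have C0 : 'C(2 * h, h)%:R != 0 :> rat by rewrite pnatr_eq0 -lt0n bin_gt0 leq_pmull.
apply: (mulIf P0).
have -> : 2 * ((-1) ^+ h * 16 ^+ h / (N%:R * 'C(2 * h, h)%:R))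
   * \prod_(i < N.+1) (x + i%:R)
   = 2 * (\prod_(i < N.+1) (x + i%:R) * ((-1) ^+ h * 16 ^+ h))
     / (N%:R * 'C(2 * h, h)%:R) by ring.
rewrite PE; field.
by rewrite P0 N0 C0.
Qed.

(** * Sums of squares of binomial coefficients modulo p^2 *)

Lemma ltn_prime_ndvd (p k : nat) : (0 < k < p)%N -> ~~ (p %| k)%N.
Proof. by case/andP=> k0 kp; rewrite gtnNdvd. Qed.

Lemma ndvd_bin (p n k : nat) : prime p -> (k <= n)%N -> (n < p)%N ->
  ~~ (p %| 'C(n, k))%N.
Proof.
move=> pp kn np; apply/negP => h.
have : (p %| n`!)%N by rewrite -(bin_fact kn) dvdn_mulr.
apply/negP; elim: n np {kn h} => [|n IH] np.
  by rewrite fact0 dvdn1; case: p pp {np} => [|[]].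
by rewrite factS Euclid_dvdM // gtnNdvd //=; apply/IH/ltnW.
Qed.

(** From j binom(pL, j) = pL binom(pL-1, j-1), where p does not divide j. *)
Lemma dvdn_bin_mulp (p L j : nat) : prime p -> (0 < j < p)%N ->
  (p %| 'C(p * L, j))%N.
Proof.
case: j => // j pp hj.
have : (p %| j.+1 * 'C(p * L, j.+1))%N.
  by rewrite -mul_bin_diag -mulnA dvdn_mulr.
by rewrite Euclid_dvdM // (negPf (ltn_prime_ndvd hj)).
Qed.

Lemma congr_dvdn (p m a : nat) : prime p -> (m %| a)%N -> congr_Zp p m a%:R 0.
Proof.
move=> pp h; rewrite -[0]/(0%:~R) [a%:R]pmulrn.
by apply: congr_int; rewrite ?subr0.
Qed.

(** Pascal's rule carries the congruence from N = 0, where it is the divisibility of binom(pL, k)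
    for 0 < k < p. *)
Lemma congr_bin_addp (p L N k : nat) : prime p -> (k < p)%N ->
  congr_Zp p p 'C(N + p * L, k)%:R 'C(N, k)%:R.
Proof.
move=> pp; elim: N k => [|N IH] [|k] hk.
- by rewrite !bin0; apply: congr_refl => //; apply: p_integral_nat.
- by rewrite add0n bin0n; apply: congr_dvdn => //; apply: dvdn_bin_mulp.
- by rewrite !bin0; apply: congr_refl => //; apply: p_integral_nat.
- by rewrite addSn !binS !natrD; apply: congrD => //; apply: IH; rewrite // ltnW.
Qed.

Lemma congr_bin_predp (p L i : nat) : prime p -> (0 < L)%N -> (i < p)%N ->
  congr_Zp p p 'C((p * L).-1, i)%:R ((-1) ^+ i).
Proof.
move=> pp L0; have pL : (0 < p * L)%N by rewrite muln_gt0 prime_gt0.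
elim: i => [|i IH] hi.
  by rewrite bin0; apply: congr_refl => //; apply: p_integral_nat.
have e : 'C((p * L).-1, i.+1)%:R
    = 'C(p * L, i.+1)%:R - 'C((p * L).-1, i)%:R :> rat.
  by rewrite -[in RHS](prednK pL) binS natrD addrK.
rewrite e exprS mulN1r -[X in congr_Zp _ _ _ X]add0r; apply: congrB => //.
  by apply: congr_dvdn => //; apply: dvdn_bin_mulp.
by apply: IH; rewrite ltnW.
Qed.

(** Absorption writes (j+1) binom(pL, j+1) as pL binom(pL-1, j); with p explicit, the last binomial
    is needed modulo p only, where it is (-1)^j. *)
Lemma congr_bin_mulp (p L j : nat) : prime p -> (0 < L)%N -> (j.+1 < p)%N ->
  congr_Zp p (p ^ 2) 'C(p * L, j.+1)%:R (p%:R * L%:R * (-1) ^+ j / j.+1%:R).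
Proof.
move=> pp L0 hj; have j0 : j.+1%:R != 0 :> rat by rewrite pnatr_eq0.
apply: (congr_cancel (u := j.+1%:R)) => //.
  by apply: p_integral_invn; apply: ltn_prime_ndvd.
rewrite -natrM -mul_bin_diag (mulrC j.+1%:R) divfK // natrM natrM -!mulrA.
apply: congr_scale => //; apply: congrMl => //; first exact: p_integral_nat.
by apply: congr_bin_predp => //; rewrite ltnW.
Qed.

(** Symmetry replaces binom(N, N-k) by binom(N, k), whose vanishing for k > N allows the summation
    range of the theorem. *)
Lemma alt_conv_extend (M N p : nat) : (N < p)%N ->
  alt_conv M N N = \sum_(k < p) (-1) ^+ k * ('C(M, k)%:R * 'C(N, k)%:R).
Proof.
move=> hN; rewrite -(subnKC hN) big_split_ord /= [X in _ + X]big1 ?addr0.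
  by apply: eq_bigr => k _; rewrite bin_sub // -ltnS.
by move=> k _; rewrite ['C(N, _)]bin_small ?mulr0 // addSn ltnS leq_addr.
Qed.

Lemma p_integral_sign (p k : nat) : prime p -> (-1) ^+ k \in p_integral p.
Proof.
by move=> pp; apply: p_integralX => //; rewrite p_integralN // (p_integral_nat 1).
Qed.

Lemma congr_sum_sqr_bin (p L N : nat) : prime p -> (N < p)%N ->
  congr_Zp p (p ^ 2) (\sum_(k < p) (-1) ^+ k * 'C(N + p * L, k)%:R ^+ 2)
    (2 * alt_conv (N + p * L) N N - alt_conv N N N).
Proof.
move=> pp hN; rewrite !(alt_conv_extend _ hN) mulr_sumr -sumrB.
apply: congr_sum => // k _ _.
rewrite [2 * _]mulrCA -mulrBr; apply: congrMl => //; first exact: p_integral_sign.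
have h := congr_bin_addp L N pp (ltn_ord k).
rewrite expr2 (_ : 2 * _ = 'C(N + p * L, k)%:R * 'C(N, k)%:R +
  'C(N, k)%:R * 'C(N + p * L, k)%:R); last by ring.
exact: congr_mul_sub.
Qed.

(** For odd N the diagonal term of [congr_sum_sqr_bin] vanishes. In the other term [alt_conv_shift]
    leaves binom(pL, N-2i) with 0 < N-2i < p, each congruent to pL/(N-2i) modulo p^2. *)
Lemma sum_sqr_bin_odd (p L h : nat) : prime p -> p = L.*2.+1 ->
  (h.*2.+1 < p)%N ->
  congr_Zp p (p ^ 2) (\sum_(k < p) (-1) ^+ k * 'C(h.*2.+1 + p * L, k)%:R ^+ 2)
    (p%:R * ((-1) ^+ h * 16 ^+ h / (h.*2.+1%:R * 'C(2 * h, h)%:R))).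
Proof.
move=> pp pE hp; set N := h.*2.+1; rewrite -half_partial_fraction -/N.
have L0 : (0 < L)%N by case: L pE pp => // ->.
apply: (congr_trans pp (congr_sum_sqr_bin L pp hp)).
rewrite alt_conv_diag /= odd_double /= subr0 alt_conv_shift -/N.
set H := \sum_(i < h.+1) _ / _.
have oddE (i : 'I_h.+1) : (N - i.*2 = ((h - i).*2).+1)%N.
  by rewrite doubleB /N subSn // leq_double -ltnS.
have iN (i : 'I_h.+1) : (N - i.*2)%:R = N%:R - 2 * i%:R :> rat.
  rewrite natrB; first by rewrite -mul2n natrM.
  by rewrite /N leqW // leq_double -ltnS.
have Nip (i : 'I_h.+1) : (N - i.*2 < p)%N by apply: leq_ltn_trans hp; rewrite leq_subr.
have Hint : H \in p_integral p.
  rewrite /H; apply: (big_ind (fun x => x \in p_integral p)).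
  - exact: (p_integral_nat 0).
  - by move=> *; apply: p_integralD.
  move=> i _; rewrite -iN; apply: p_integralM => //; last first.
    by apply: p_integral_invn; apply: ltn_prime_ndvd; rewrite Nip oddE.
  by apply: p_integralM => //; [apply: p_integral_sign | apply: p_integral_nat].
apply: (congr_trans (b := 2 * - (p%:R * L%:R * H))) => //.
  apply: congrMl => //; first exact: p_integral_nat.
  apply: congrN; rewrite mulr_sumr; apply: congr_sum => // i _ _.
  rewrite (_ : p%:R * L%:R * _ = (-1) ^+ i *
    ('C(N, i)%:R * (p%:R * L%:R / (N%:R - 2 * i%:R)))); last by ring.
  apply: congrMl => //; first exact: p_integral_sign.
  apply: congrMl => //; first exact: p_integral_nat.
  (* The lower index is j+1 with j even, so the sign (-1)^j in [congr_bin_mulp] is 1. *)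
  rewrite -iN oddE; set j := (h - i).*2.
  have := congr_bin_mulp (j := j) pp L0.
  rewrite -oddE Nip -[in (-1) ^+ j]signr_odd odd_double mulr1; exact.
split.
- by rewrite !(p_integralN, p_integralM) // p_integral_nat.
- by rewrite p_integralM // p_integral_nat.
(* Since 2L = p-1, the difference -2pLH - pH equals -p^2 H. *)
exists (- H); first exact: p_integralN.
rewrite natrX (_ : L%:R = (p%:R - 1) / 2); first by field.
by rewrite pE -natr1 -muln2 natrM; field.
Qed.

(** The coefficient of X^m in (1-X^2)^M is a sum of products binom(M, k) binom(M, m-k). Linearizing
    these products gives the same expression as linearizing the squares, so the two sums agree
    modulo p^2. *)
Lemma sum_sqr_bin_even (p L m : nat) : prime p -> ~~ odd m -> (m < p)%N ->
  congr_Zp p (p ^ 2) (\sum_(k < p) (-1) ^+ k * 'C(m + p * L, k)%:R ^+ 2)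
    ((-1) ^+ m./2 * 'C(m + p * L, m./2)%:R).
Proof.
move=> pp evm hm; set M := (m + p * L)%N.
have := alt_conv_diag M m; rewrite (negPf evm) => <-.
apply: (congr_trans pp (congr_sum_sqr_bin L pp hm)); apply: congr_sym.
(* One of the two copies of the mixed sum is reversed by k -> m-k; the signs are kept because m is
   even. *)
have -> : 2 * alt_conv M m m - alt_conv m m m = \sum_(k < m.+1)
   (-1) ^+ k * ('C(M, k)%:R * 'C(m, k)%:R
      + 'C(m, k)%:R * 'C(M, m - k)%:R - 'C(m, k)%:R * 'C(m, k)%:R).
  under [RHS]eq_bigr => k _ do rewrite mulrBr mulrDr.
  rewrite sumrB big_split /= mulr_natl mulr2n; congr (_ + _ - _).
  - by apply: eq_bigr => k _; rewrite bin_sub // -ltnS.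
  - rewrite /alt_conv (reindex_inj rev_ord_inj) /=; apply: eq_bigr => k _.
    have km : (k <= m)%N by rewrite -ltnS.
    rewrite subSS subKn // -signr_odd oddB // (negPf evm) /= signr_odd.
    by rewrite [X in _ * X]mulrC.
  - by apply: eq_bigr => k _; rewrite bin_sub // -ltnS.
apply: congr_sum => // k _ _; apply: congrMl => //; first exact: p_integral_sign.
have km : (k <= m)%N by rewrite -ltnS.
apply: congr_mul_sub => //.
  by apply: congr_bin_addp => //; apply: leq_ltn_trans hm.
rewrite -(bin_sub km).
by apply: congr_bin_addp => //; apply: leq_ltn_trans (leq_subr _ _) hm.
Qed.

(** * Binomial coefficients [gbin a k] with rational upper index *)

Definition gbin (a : rat) (k : nat) : rat :=
  \prod_(i < k) ((a - i%:R) / i.+1%:R).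

Lemma gbin0 (a : rat) : gbin a 0 = 1.
Proof. exact: big_ord0. Qed.

Lemma gbinS (a : rat) (k : nat) :
  gbin a k.+1 = gbin a k * ((a - k%:R) / k.+1%:R).
Proof. exact: big_ord_recr. Qed.

(** The recurrence of [gbinS] at an integer upper index. Subtraction is taken in [rat], and for k >
    M both sides vanish. *)
Lemma natr_binS (M k : nat) : 'C(M, k.+1)%:R
  = 'C(M, k)%:R * ((M%:R - k%:R) / k.+1%:R) :> rat.
Proof.
have k0 : k.+1%:R != 0 :> rat by rewrite pnatr_eq0.
have := congr1 (fun n => n%:R : rat) (mul_bin_left M k).
rewrite !natrM => e; apply: (mulfI k0); rewrite e.
case: (leqP k M) => hk.
  by rewrite natrB // mulrCA [k.+1%:R * _]mulrC divfK // mulrC.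
by rewrite (bin_small hk) mulr0 mul0r mulr0.
Qed.

(** The denominators 1, ..., k are invertible because k < p, so the product depends on [a] only
    through its class modulo m. *)
Lemma congr_gbin (p m M k : nat) (a : rat) : prime p -> (k < p)%N ->
  congr_Zp p m a M%:R -> congr_Zp p m (gbin a k) 'C(M, k)%:R.
Proof.
move=> pp hk haM; elim: k hk => [|k IH] hk.
  by rewrite gbin0 bin0; apply: congr_refl => //; apply: (p_integral_nat 1).
rewrite gbinS natr_binS; apply: congrM => //; first by apply: IH; rewrite ltnW.
apply: congrM => //.
  by apply: congrB => //; apply: congr_refl => //; apply: p_integral_nat.
by apply: congr_refl => //; apply: p_integral_invn; apply: ltn_prime_ndvd.
Qed.

Lemma gbin_half (k : nat) :
  gbin (1 / 2) k = 'C(2 * k, k)%:R / ((- 4) ^+ k * (1 - 2 * k%:R)).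
Proof.
have odd_ne (j : nat) : 1 - 2 * j%:R != 0 :> rat.
  rewrite subr_eq0 -natrM (eqr_nat _ 1); apply/eqP => e.
  by have := congr1 odd e; rewrite oddM.
elim: k => [|k IH]; first by rewrite gbin0 bin0 expr0; field.
rewrite gbinS IH central_binS_rat exprS -natr1; field.
by rewrite expf_neq0 // nat1r odd_ne natr1 pnatr_eq0 odd_ne.
Qed.

Lemma gbin_Nhalf (k : nat) : gbin (- (1 / 2)) k = 'C(2 * k, k)%:R / (- 4) ^+ k.
Proof.
elim: k => [|k IH]; first by rewrite gbin0 bin0 expr0; field.
rewrite gbinS IH central_binS_rat exprS -natr1; field.
by rewrite expf_neq0 // natr1 pnatr_eq0.
Qed.

(** * The quadratic character of a finite field *)

(** The quadratic character, defined by Euler's criterion. Its values are integers, so that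
    character sums can be squared and compared in size, not only modulo p. *)
Definition qchar (F : finFieldType) (t : F) : int :=
  if t == 0 then 0 else if t ^+ (#|F|.-1)./2 == 1 then 1 else -1.

Lemma expf_card_pred (F : finFieldType) (t : F) : t != 0 -> t ^+ #|F|.-1 = 1.
Proof.
move=> t0; apply: (mulfI t0); rewrite mulr1 -exprS prednK ?expf_card //.
by apply/card_gt0P; exists t.
Qed.

(** The translation t -> t+1 permutes F and adds the cardinality to the sum of all elements. *)
Lemma card_finField_natr (F : finFieldType) : #|F|%:R = 0 :> F.
Proof.
have e : \sum_(t : F) t = \sum_(t : F) t + #|F|%:R.
  rewrite [LHS](reindex_inj (addIr 1)) /= big_split /=; congr (_ + _).
  by rewrite sumr_const.
by apply: (addrI (\sum_(t : F) t)); rewrite -e addr0.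
Qed.

Lemma finField_prim_root (F : finFieldType) :
  exists g : F, (#|F|.-1).-primitive_root g.
Proof.
have F1 : (1 < #|F|)%N := finNzRing_gt1 F.
pose rs := [seq x <- enum F | x != 0].
have h : has (#|F|.-1).-primitive_root rs.
  apply: has_prim_root.
  - by rewrite -ltnS prednK // ltnW.
  - apply/allP => x; rewrite mem_filter => /andP [x0 _].
    by rewrite unity_rootE expf_card_pred.
  - by rewrite filter_uniq // enum_uniq.
  - rewrite -(cardC1 (0 : F)) cardE /rs enumT !size_filter.
    by apply/eq_leq/eq_count => x; rewrite !inE.
by case/hasP: h => g _ hg; exists g.
Qed.

Lemma prim_root_neq0 (F : fieldType) (k : nat) (g : F) :
  k.-primitive_root g -> g != 0.
Proof.
move=> hg; apply/eqP => g0; have := prim_expr_order hg.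
by rewrite g0 expr0n gtn_eqF ?(prim_order_gt0 hg) // => /esym/eqP; rewrite oner_eq0.
Qed.

Lemma sum_prim_root (F : finFieldType) (g : F) (G : F -> int) :
  (#|F|.-1).-primitive_root g ->
  \sum_(t | t != 0) G t = \sum_(0 <= i < #|F|.-1) G (g ^+ i).
Proof.
move=> hg; rewrite -(big_map (fun i => g ^+ i) xpredT G) -big_enum /=.
have g0 i : g ^+ i != 0.
  by rewrite expf_neq0 // (prim_root_neq0 hg).
apply: perm_big; apply: uniq_perm; first exact: enum_uniq.
  rewrite map_inj_in_uniq ?iota_uniq // => i j.
  rewrite !mem_index_iota /= => hi hj /eqP.
  by rewrite (eq_prim_root_expr hg) !modn_small // => /eqP.
move=> t; rewrite mem_enum; apply/idP/mapP => [t0|[i _ ->]]; last exact: g0.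
have [i ->] := prim_rootP hg (expf_card_pred t0).
by exists (i : nat); rewrite // mem_index_iota /=.
Qed.

Lemma sqr_half_card (F : finFieldType) (t : F) : odd #|F| -> t != 0 ->
  t ^+ (#|F|.-1)./2 = 1 \/ t ^+ (#|F|.-1)./2 = -1.
Proof.
move=> oF t0; set n := (_./2).
have nE : (n * 2 = #|F|.-1)%N.
  by rewrite muln2 even_halfK // -oddS prednK //; apply/card_gt0P; exists t.
have : (t ^+ n) ^+ 2 == 1 by rewrite -exprM nE expf_card_pred.
by rewrite sqrf_eq1 => /orP [] /eqP ->; [left | right].
Qed.

Lemma two_neq0 (F : finFieldType) : odd #|F| -> 2 != 0 :> F.
Proof.
move=> oF; apply/eqP => e2; have := card_finField_natr F.
rewrite -(odd_double_half #|F|) oF natrD -mul2n natrM e2 mul0r addr0.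
by move/eqP; rewrite oner_eq0.
Qed.

Lemma qchar0 (F : finFieldType) : qchar (0 : F) = 0.
Proof. by rewrite /qchar eqxx. Qed.

Lemma half_card_gt0 (F : finFieldType) : odd #|F| -> (0 < (#|F|.-1)./2)%N.
Proof. by have := finNzRing_gt1 F; case: #|F| => [|[|[|k]]]. Qed.

Lemma qchar_expr (F : finFieldType) (t : F) : odd #|F| ->
  (qchar t)%:~R = t ^+ (#|F|.-1)./2.
Proof.
move=> oF; rewrite /qchar; case: eqVneq => [->|t0].
  by rewrite expr0n gtn_eqF // half_card_gt0.
by case: (sqr_half_card oF t0) => ->; rewrite ?eqxx //; case: eqP => // ->.
Qed.

Lemma qchar_sign (F : finFieldType) (t : F) : odd #|F| -> t != 0 ->
  qchar t = 1 \/ qchar t = -1.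
Proof.
by move=> oF t0; rewrite /qchar (negPf t0); case: ifP; [left | right].
Qed.

(** Lifts an identity from F to the integers: 1 and -1 stay distinct in F because 2 is nonzero
    there. *)
Lemma qchar_inj (F : finFieldType) (t : F) (z : int) : odd #|F| -> t != 0 ->
  z = 1 \/ z = -1 -> t ^+ (#|F|.-1)./2 = z%:~R -> qchar t = z.
Proof.
move=> oF t0 hz; rewrite -qchar_expr //.
have ne : 1 != -1 :> F.
  by rewrite -subr_eq0 opprK; exact: two_neq0.
case: (qchar_sign oF t0) hz => -> [] -> //.
  by move/eqP; rewrite rmorphN /= (negPf ne).
by move/esym/eqP; rewrite rmorphN /= (negPf ne).
Qed.

Lemma qcharM (F : finFieldType) (s t : F) : odd #|F| ->
  qchar (s * t) = qchar s * qchar t.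
Proof.
move=> oF; have [->|s0] := eqVneq s 0; first by rewrite mul0r qchar0 mul0r.
have [->|t0] := eqVneq t 0; first by rewrite mulr0 qchar0 mulr0.
apply: qchar_inj; rewrite ?mulf_neq0 //; last first.
  by rewrite rmorphM /= !qchar_expr // exprMn.
by case: (qchar_sign oF s0) => ->; case: (qchar_sign oF t0) => ->; auto.
Qed.

Lemma qchar1 (F : finFieldType) : odd #|F| -> qchar (1 : F) = 1.
Proof. by move=> oF; apply: qchar_inj; rewrite ?oner_neq0 ?expr1n //; left. Qed.

Lemma qchar_sqr (F : finFieldType) (t : F) : odd #|F| -> t != 0 ->
  qchar t * qchar t = 1.
Proof. by move=> oF t0; case: (qchar_sign oF t0) => ->. Qed.

Lemma half_prim_root (F : finFieldType) (g : F) : odd #|F| ->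
  (#|F|.-1).-primitive_root g -> g ^+ (#|F|.-1)./2 = -1.
Proof.
move=> oF hg; case: (sqr_half_card oF (prim_root_neq0 hg)) => // /eqP.
rewrite -(prim_order_dvd hg) => /dvdn_leq.
have n0 := half_card_gt0 oF; move=> /(_ n0).
have : (#|F|.-1 = (#|F|.-1)./2 + (#|F|.-1)./2)%N.
  rewrite addnn even_halfK // -oddS prednK //.
  exact: ltnW (finNzRing_gt1 F).
by lia.
Qed.

Lemma qchar_prim_root (F : finFieldType) (g : F) (i : nat) : odd #|F| ->
  (#|F|.-1).-primitive_root g -> qchar (g ^+ i) = (-1) ^+ i.
Proof.
move=> oF hg; apply: qchar_inj => //.
- by rewrite expf_neq0 // (prim_root_neq0 hg).
- by rewrite -signr_odd; case: (odd i); [right | left].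
- by rewrite exprAC half_prim_root // rmorphXn /= rmorphN.
Qed.

(** Multiplication by a primitive root permutes F and changes the sign of the character. *)
Lemma sum_qchar (F : finFieldType) : odd #|F| -> \sum_(t : F) qchar t = 0.
Proof.
move=> oF; have [g hg] := finField_prim_root F.
have e : \sum_(t : F) qchar t = - \sum_(t : F) qchar t.
  rewrite [LHS](reindex_inj (mulfI (prim_root_neq0 hg))) /= -sumrN.
  apply: eq_bigr => t _.
  by rewrite qcharM // -{1}[g]expr1 qchar_prim_root // expr1 mulN1r.
by lia.
Qed.

(** Substituting g t for t, with g a primitive root, multiplies the sum by g^k; it vanishes unless
    g^k = 1, when every nonzero t contributes 1. *)
Lemma sum_expf (F : finFieldType) (k : nat) : (0 < k)%N ->
  \sum_(t : F) t ^+ k = if (#|F|.-1 %| k)%N then -1 else 0.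
Proof.
move=> k0; have [g hg] := finField_prim_root F.
case: ifP => hk.
  rewrite (bigD1 0) //= expr0n gtn_eqF // add0r.
  rewrite (eq_bigr (fun=> 1)); last first.
    by move=> t t0; case/dvdnP: hk => q ->; rewrite mulnC exprM expf_card_pred ?expr1n.
  rewrite sumr_const -[LHS](addKr 1) nat1r.
  have -> : #|[pred t : F | t != 0]| = #|F|.-1 by exact: cardC1.
  rewrite prednK ?card_finField_natr ?addr0 //.
  exact: ltnW (finNzRing_gt1 F).
have e : \sum_(t : F) t ^+ k = g ^+ k * \sum_(t : F) t ^+ k.
  rewrite [LHS](reindex_inj (mulfI (prim_root_neq0 hg))) mulr_sumr /=.
  by apply: eq_bigr => t _; rewrite exprMn.
have : (g ^+ k - 1) * \sum_(t : F) t ^+ k = 0.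
  by rewrite mulrBl mul1r -e subrr.
by move/eqP; rewrite mulf_eq0 subr_eq0 -(prim_order_dvd hg) hk => /eqP.
Qed.

(** * Jacobsthal sums and Gauss's congruence *)

Definition jacobsthal (F : finFieldType) (a : F) : int :=
  \sum_(t : F) qchar t * qchar (t ^+ 2 + a).

Lemma jacobsthal0 (F : finFieldType) : odd #|F| -> jacobsthal (0 : F) = 0.
Proof.
move=> oF; rewrite -(sum_qchar oF); apply: eq_bigr => t _.
have [->|t0] := eqVneq t 0; first by rewrite qchar0 mul0r.
by rewrite addr0 expr2 qcharM // qchar_sqr // mulr1.
Qed.

(** Substitute c t for t. Hence the square of the sum depends only on the square class of [a]. *)
Lemma jacobsthal_scale (F : finFieldType) (a c : F) : odd #|F| -> c != 0 ->
  jacobsthal (c ^+ 2 * a) = qchar c * jacobsthal a.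
Proof.
move=> oF c0; rewrite /jacobsthal (reindex_inj (mulfI c0)) mulr_sumr /=.
apply: eq_bigr => t _; rewrite exprMn -mulrDr (expr2 c) !qcharM //.
by rewrite qchar_sqr // mul1r mulrA.
Qed.

Lemma sum_neq0_const (F : finFieldType) (c : int) :
  \sum_(t : F | t != 0) c = c * (#|F|%:Z - 1).
Proof.
have : \sum_(t : F) c = c *+ #|F| by rewrite sumr_const.
rewrite (bigD1 0) //= -mulr_natr natz mulrBr mulr1 => <-.
by rewrite [c + _]addrC addrK.
Qed.

(** After translation, with d = s-r, inverting the variable turns the summand into
    [qchar (1 + d * a)] over nonzero a. For nonzero d this is the full character sum, which is 0,
    without its value 1 at a = 0. *)
Lemma qchar_corr (F : finFieldType) (r s : F) : odd #|F| ->
  \sum_(a : F) qchar (r + a) * qchar (s + a)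
  = if r == s then #|F|%:Z - 1 else -1.
Proof.
move=> oF; rewrite (reindex_inj (addrI (- r))) /=.
under eq_bigr => a _ do rewrite addrA subrr add0r addrA.
set d := s - r; have -> : (r == s) = (d == 0) by rewrite /d subr_eq0 eq_sym.
rewrite (bigD1 0) //= qchar0 mul0r add0r.
have -> : \sum_(a | a != 0) qchar a * qchar (d + a)
  = \sum_(a : F | a != 0) qchar (1 + d * a).
  rewrite (reindex_inj invr_inj) /=.
  apply: eq_big => a; first by rewrite invr_eq0.
  rewrite invr_eq0 => a0; rewrite -qcharM //.
  have -> : a^-1 * (d + a^-1) = (a^-1 * a^-1) * (1 + d * a).
    by field.
  by rewrite !qcharM // qchar_sqr ?invr_eq0 // mul1r.
case: eqVneq => [->|d0].
  under eq_bigr => a _ do rewrite mul0r addr0 qchar1 //.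
  by rewrite sum_neq0_const mul1r.
have := sum_qchar oF; rewrite (reindex_inj (addrI 1)) (reindex_inj (mulfI d0)).
rewrite (bigD1 0) //= mulr0 addr0 qchar1 // => /eqP.
by rewrite addrC addr_eq0 => /eqP.
Qed.

(** Expand the square and sum over a first: [qchar_corr] then singles out the pairs with u = t or u
    = -t. *)
Lemma jacobsthal_moment (F : finFieldType) : odd #|F| -> qchar (-1 : F) = 1 ->
  \sum_(a : F) jacobsthal a ^+ 2 = 2 * #|F|%:Z * (#|F|%:Z - 1).
Proof.
move=> oF chi1.
have -> : \sum_(a : F) jacobsthal a ^+ 2 = \sum_(t : F) \sum_(u : F)
    qchar t * qchar u * (if t ^+ 2 == u ^+ 2 then #|F|%:Z - 1 else -1).
  transitivity (\sum_(a : F) \sum_(t : F) \sum_(u : F) qchar t * qchar u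
     * (qchar (t ^+ 2 + a) * qchar (u ^+ 2 + a))).
    apply: eq_bigr => a _; rewrite expr2 /jacobsthal mulr_suml.
    apply: eq_bigr => t _; rewrite mulr_sumr.
    by apply: eq_bigr => u _; rewrite mulrACA.
  rewrite exchange_big; apply: eq_bigr => t _ /=.
  rewrite exchange_big; apply: eq_bigr => u _ /=.
  by rewrite -mulr_sumr qchar_corr.
have step (t : F) : \sum_(u : F)
    qchar t * qchar u * (if t ^+ 2 == u ^+ 2 then #|F|%:Z - 1 else -1)
    = if t == 0 then 0 else 2 * #|F|%:Z.
  case: eqVneq => [->|t0].
    by rewrite big1 // => u _; rewrite qchar0 !mul0r.
  (* The case distinction is the cardinality times an indicator, minus 1; the constant part
     disappears by [sum_qchar]. *)
  transitivity (\sum_(u : F) (qchar t * #|F|%:Z *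
     (qchar u * (t ^+ 2 == u ^+ 2)%:R) - qchar t * qchar u)).
    by apply: eq_bigr => u _; case: eqP => _; rewrite /=; ring.
  rewrite sumrB -!mulr_sumr sum_qchar // mulr0 subr0.
  have tN : t != - t.
    by rewrite -subr_eq0 opprK -mulr2n -mulr_natl mulf_neq0 // two_neq0.
  rewrite (bigD1 t) //= eqxx mulr1 (bigD1 (- t)) /=; last by rewrite eq_sym.
  rewrite sqrrN eqxx mulr1 big1 ?addr0.
    rewrite -mulN1r qcharM // chi1 mul1r.
    by have := qchar_sqr oF t0; nia.
  move=> u /andP [ut uNt]; rewrite eq_sym eqf_sqr (negPf ut) (negPf uNt).
  by rewrite mulr0.
rewrite (eq_bigr _ (fun t _ => step t)) (bigD1 0) //= eqxx add0r.
under eq_bigr => t t0 do rewrite (negPf t0).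
by rewrite sum_neq0_const.
Qed.

Lemma sum_double (h : nat) (f : nat -> int) :
  \sum_(0 <= i < h.*2) f i = \sum_(0 <= i < h) (f i.*2 + f i.*2.+1).
Proof.
elim: h => [|h IH]; first by rewrite !big_nil.
by rewrite doubleS !big_nat_recr //= IH addrA.
Qed.

(* The moment identity restricted to the two square classes of F^*. *)
Lemma jacobsthal_sum_two_squares (F : finFieldType) (h : nat) (g : F) :
  #|F| = (4 * h).+1 -> (#|F|.-1).-primitive_root g ->
  jacobsthal (-1 : F) ^+ 2 + jacobsthal g ^+ 2 = 4 * #|F|%:Z.
Proof.
move=> hF hg; have oF : odd #|F| by rewrite hF /= oddM.
have g0 := prim_root_neq0 hg.
have nE : (#|F|.-1)./2 = h.*2 by rewrite hF /=; lia.
have gn : g ^+ h.*2 = -1 by rewrite -nE half_prim_root.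
have chi1 : qchar (-1 : F) = 1.
  by rewrite -gn qchar_prim_root // -signr_odd odd_double.
have sq (i : nat) (b : F) :
    jacobsthal (g ^+ i.*2 * b) ^+ 2 = jacobsthal b ^+ 2.
  rewrite -muln2 exprM jacobsthal_scale ?expf_neq0 // exprMn.
  by rewrite expr2 qchar_sqr ?expf_neq0 // mul1r.
have := jacobsthal_moment oF chi1.
rewrite (bigD1 0) //= jacobsthal0 // expr0n add0r.
rewrite (sum_prim_root (fun a => jacobsthal a ^+ 2) hg) -gn.
rewrite hF /= (_ : 4 * h = h.*2.*2)%N; last by lia.
(* Even exponents give the value at 1, which is also the value at -1 = g^(2h), and odd exponents the
   value at g; there are 2h of each. *)
rewrite sum_double; under eq_bigr => i _.
  rewrite -[g ^+ i.*2]mulr1 sq [g ^+ _.+1]exprSr sq.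
  over.
rewrite -[g ^+ h.*2]mulr1 sq sumr_const_nat subn0.
have h0 : (0 < h)%N by have := finNzRing_gt1 F; rewrite hF; lia.
move=> e; have h0' : h%:Z != 0 by lia.
by apply: (mulfI h0'); move: e; rewrite -mulr_natr natz; nia.
Qed.

(** By Euler's criterion the summand is t^(2h) (t^2 + a)^(2h). Its exponents 6h-2i lie between 2h
    and 6h, and [sum_expf] keeps only 4h, that is i = h. *)
Lemma jacobsthal_expr (F : finFieldType) (h : nat) (a : F) :
  #|F| = (4 * h).+1 ->
  (jacobsthal a)%:~R = - ('C(h.*2, h)%:R * a ^+ h).
Proof.
move=> hF; have oF : odd #|F| by rewrite hF /= oddM.
have nE : (#|F|.-1)./2 = h.*2 by rewrite hF /=; lia.
have h0 : (0 < h)%N by have := finNzRing_gt1 F; rewrite hF; lia.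
rewrite rmorph_sum /=.
transitivity (\sum_(t : F) \sum_(i < h.*2.+1)
    ('C(h.*2, i)%:R * a ^+ i) * t ^+ (h.*2 + 2 * (h.*2 - i))).
  apply: eq_bigr => t _; rewrite rmorphM /= !qchar_expr // nE exprDn mulr_sumr.
  apply: eq_bigr => i _; rewrite -exprM exprD -mulr_natl.
  by ring.
rewrite exchange_big /=.
under eq_bigr => i _ do rewrite -mulr_sumr sum_expf ?ltn_addr ?double_gt0 //.
have hh : (h < h.*2.+1)%N by lia.
rewrite (bigD1 (Ordinal hh)) //= big1 ?addr0.
  rewrite (_ : h.*2 + _ = #|F|.-1)%N ?dvdnn ?mulrN1 // hF; lia.
move=> i ih; case: ifP; last by rewrite mulr0.
rewrite hF /= => /dvdnP [q e]; have hi := ltn_ord i.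
have ih' : (i : nat) != h by rewrite -val_eqE in ih.
have : (q = 1)%N by nia.
by lia.
Qed.

Lemma sum_signs_parity (f : nat -> int) (m n : nat) : (m <= n)%N ->
  (forall i, (m <= i < n)%N -> f i = 1 \/ f i = -1) ->
  exists e : int, \sum_(m <= i < n) f i = (n - m)%N%:Z + 2 * e.
Proof.
move=> hmn; rewrite -(subnKC hmn); elim: (n - m)%N => [|k IH] hf.
  by exists 0; rewrite addn0 big_geq //; lia.
have [|e he] := IH; first by move=> i hi; apply: hf; lia.
rewrite addnS big_nat_recr ?leq_addr //= he.
have [|->|->] := hf (m + k)%N; first by lia.
- by exists e; lia.
- by exists (e - 1); lia.
Qed.

(* The orbits {t, -t, 1/t, -1/t} have four elements except for t^2 = 1 (value
   0) and t^2 = -1, where (1 + t)^2 = 2 t makes the value 1. *)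
Lemma jacobsthalN1_mod8 (F : finFieldType) (h : nat) : #|F| = (4 * h).+1 ->
  exists e : int, jacobsthal (-1 : F) = 2 * (2 * h%:Z - 1 + 4 * e).
Proof.
move=> hF; have oF : odd #|F| by rewrite hF /= oddM.
have [g hg] := finField_prim_root F; have g0 := prim_root_neq0 hg.
have nE : (#|F|.-1)./2 = h.*2 by rewrite hF /=; lia.
have gn : g ^+ h.*2 = -1 by rewrite -nE half_prim_root.
have gi0 i : g ^+ i != 0 by rewrite expf_neq0.
have h0 : (0 < h)%N by have := finNzRing_gt1 F; rewrite hF; lia.
have chi1 : qchar (-1 : F) = 1.
  by rewrite -gn qchar_prim_root // -signr_odd odd_double.
have chiN (x : F) : qchar (- x) = qchar x.
  by rewrite -mulN1r qcharM // chi1 mul1r.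
pose f i := qchar (g ^+ i) * qchar ((g ^+ i) ^+ 2 + -1).
have fD i : f (i + h.*2)%N = f i.
  by rewrite /f exprD gn mulrN1 sqrrN chiN.
(* As g^(2h) = -1, the exponent 2h-i stands for the element -1/g^i. *)
have fR i : (i <= h.*2)%N -> f (h.*2 - i)%N = f i.
  move=> hi; have -> : f (h.*2 - i)%N =
      qchar (- (g ^+ i)^-1) * qchar ((- (g ^+ i)^-1) ^+ 2 + -1).
    rewrite /f; suff -> : g ^+ (h.*2 - i) = - (g ^+ i)^-1 by [].
    apply: (mulIf (gi0 i)); rewrite -exprD subnK // gn mulNr mulVf //.
  set x := g ^+ i; have x0 : x != 0 by exact: gi0.
  have xV : x^-1 != 0 by rewrite invr_eq0.
  rewrite chiN sqrrN /f -/x -[in RHS](chiN (x ^+ 2 + -1)).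
  congr (_ * _); rewrite -[RHS]mulr1 -(qchar_sqr oF xV) -!qcharM //.
    by congr qchar; field.
  by congr qchar; field.
have f0 : f 0%N = 0 by rewrite /f expr0 expr1n subrr qchar0 mulr0.
have fh : f h = 1.
  rewrite /f -exprM muln2 gn -qcharM //.
  set x := g ^+ h; have x2 : x ^+ 2 = -1 by rewrite -exprM muln2.
  have x1 : (1 + x) * (1 + x) = 2 * x.
    by rewrite -expr2 sqrrD x2 expr1n mul1r mulr_natl addrAC subrr add0r.
  have x10 : 1 + x != 0.
    apply/eqP => e; have : 2 * x == 0 by rewrite -x1 e mul0r.
    by rewrite mulf_eq0 (negPf (two_neq0 oF)) (negPf (gi0 h)).
  rewrite -(qchar_sqr oF x10) -qcharM // x1 -chiN; congr qchar.
  by ring.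
have fs i : (1 <= i < h)%N -> f i = 1 \/ f i = -1.
  move=> hi; rewrite /f -qcharM //; apply: qchar_sign => //.
  rewrite mulf_neq0 // subr_eq0 -exprM -(prim_order_dvd hg) hF /=.
  by apply/negP => /dvdn_leq; lia.
have [e he] := sum_signs_parity h0 fs; exists e.
rewrite /jacobsthal (bigD1 0) //= qchar0 mul0r add0r.
rewrite (sum_prim_root (fun t => qchar t * qchar (t ^+ 2 + -1)) hg) -/f hF /=.
(* With S the sum of f over 0 < i < h, the symmetries give 2 (S + 1 + S), and S is h-1 plus an even
   number. *)
have -> : \sum_(0 <= i < 4 * h) f i = 2 * \sum_(0 <= i < h.*2) f i.
  rewrite (@big_cat_nat _ _ _ h.*2) //=; last by lia.
  rewrite -{2}[h.*2]add0n big_addn (_ : 4 * h - h.*2 = h.*2)%N; last by lia.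
  by under [X in _ + X]eq_bigr => i _ do rewrite fD; rewrite mulr_natl.
congr (_ * _); rewrite big_ltn ?double_gt0 // f0 add0r.
rewrite (@big_cat_nat _ _ _ h) //=; last by lia.
rewrite he [X in _ + X]big_ltn ?fh; last by lia.
have -> : \sum_(h.+1 <= i < h.*2) f i = \sum_(1 <= i < h) f i.
  rewrite -add1n big_addn (_ : h.*2 - h = h)%N; last by lia.
  rewrite big_nat_rev /=; apply: eq_big_nat => i hi.
  by rewrite -fR; [congr f | ]; lia.
by rewrite he; lia.
Qed.

(** * Uniqueness of the two-square representation, and Gauss's congruence *)

Lemma int_parity (b : int) : exists c, b = 2 * c \/ b = 2 * c + 1.
Proof.
exists (divz b 2); have := divz_eq b 2.
have := modz_ge0 b (isT : 2 != 0 :> int).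
have := ltz_pmod b (isT : 0 < 2 :> int); lia.
Qed.

(** For u = 2y or u = -2y, p divides xb - ua. In p^2 = (xa+ub)^2 + (xb-ua)^2 the first term is odd,
    hence nonzero, so xb = ua. Then x^2 = a^2, and the congruences modulo 4 fix the sign. *)
Lemma two_squares_unique (p : nat) (a b x y : int) : prime p ->
  p%:Z = a ^+ 2 + b ^+ 2 -> p%:Z = x ^+ 2 + 4 * y ^+ 2 ->
  (4 %| a - 1)%Z -> (4 %| x - 1)%Z -> a = x.
Proof.
move=> pp pa px /dvdzP [a' /eqP ea] /dvdzP [x' /eqP ex].
rewrite subr_eq in ea; rewrite subr_eq in ex; move/eqP: ea => ea; move/eqP: ex => ex.
have p0 : p%:Z != 0 by case: p pp {pa px}.
(* An odd b would make a^2 + b^2 even, while x^2 + 4y^2 is odd. *)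
have [c ec] : exists c, b = 2 * c.
  have [c [->|eb]] := int_parity b; first by exists c.
  have e1 : p%:Z = 2 * (8 * x' ^+ 2 + 4 * x' + 2 * y ^+ 2) + 1.
    by rewrite px ex; ring.
  have e2 : p%:Z = 2 * (8 * a' ^+ 2 + 4 * a' + 2 * c ^+ 2 + 2 * c + 1).
    by rewrite pa ea eb; ring.
  by move: e1 e2; move: (_ + _ + _) (_ + _ + _) => z z'; lia.
have key (u : int) : u ^+ 2 = 4 * y ^+ 2 -> (exists v, u = 2 * v) ->
    (p%:Z %| x * b - u * a)%Z -> a = x.
  move=> eu [v ev] /dvdzP [k ek].
  have e1 : p%:Z ^+ 2 = (x * a + u * b) ^+ 2 + (x * b - u * a) ^+ 2.
    by rewrite expr2 {1}px pa -eu; ring.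
  have odd1 : x * a + u * b != 0.
    have -> : x * a + u * b = 2 * (8 * x' * a' + 2 * x' + 2 * a' + 2 * v * c) + 1.
      by rewrite ev ec ex ea; ring.
    by move: (_ + _ + _) => z; lia.
  have k0 : k = 0.
    apply/eqP; apply: contraT => k0.
    have k2 : 0 < k ^+ 2 by rewrite exprn_even_gt0.
    have s2 : 0 < (x * a + u * b) ^+ 2 by rewrite exprn_even_gt0.
    have e : p%:Z ^+ 2 * (1 - k ^+ 2) = (x * a + u * b) ^+ 2.
      by rewrite -[RHS](addrK ((x * b - u * a) ^+ 2)) -e1 ek; ring.
    move: s2; rewrite -e pmulr_rgt0; last by rewrite exprn_even_gt0.
    by move: (k ^+ 2) k2 => z; lia.
  have e2 : x * b = u * a by apply/eqP; rewrite -subr_eq0 ek k0 mul0r.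
  have : p%:Z * (x ^+ 2 - a ^+ 2) = 0.
    rewrite mulrBr {1}pa px -eu.
    have -> : (a ^+ 2 + b ^+ 2) * x ^+ 2 - (x ^+ 2 + u ^+ 2) * a ^+ 2
      = (x * b) ^+ 2 - (u * a) ^+ 2 by ring.
    by rewrite e2 subrr.
  move/eqP; rewrite mulf_eq0 (negPf p0) /= subr_eq0 eqf_sqr.
  by case/orP => /eqP; clear -ea ex; lia.
have : (p%:Z %| (x * b - 2 * y * a) * (x * b - (- (2 * y)) * a))%Z.
  apply/dvdzP; exists (x ^+ 2 - a ^+ 2).
  have -> : (x * b - 2 * y * a) * (x * b - - (2 * y) * a) =
     x ^+ 2 * (a ^+ 2 + b ^+ 2) - (x ^+ 2 + 4 * y ^+ 2) * a ^+ 2 by ring.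
  by rewrite -pa -px; ring.
rewrite dvdzE abszM Euclid_dvdM // => /orP [] h.
- by apply: (key (2 * y)); [ring | exists y | rewrite dvdzE].
- by apply: (key (- (2 * y))); [ring | exists (- y); ring | rewrite dvdzE].
Qed.

(** The Jacobsthal sum at -1 is 2A with p = A^2 + b^2, and modulo p it is -(-1)^h binom(2h, h). The
    normalization A = 2h-1 modulo 4 makes -(-1)^h A congruent to 1 modulo 4, hence equal to x. *)
Lemma gauss_binomial (p h : nat) (x y : int) : prime p -> p = (4 * h).+1 ->
  p%:Z = x ^+ 2 + 4 * y ^+ 2 -> (4 %| x - 1)%Z ->
  (p%:Z %| 'C(h.*2, h)%:Z - 2 * x)%Z.
Proof.
move=> pp pE px hx; have cF : #|'F_p| = (4 * h).+1 by rewrite card_Fp.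
have [g hg] := finField_prim_root 'F_p.
have [e he] := jacobsthalN1_mod8 cF.
have sq := jacobsthal_sum_two_squares cF hg; rewrite cF -pE in sq.
have := jacobsthal_expr (-1) cF; rewrite he => hG.
move AE : (2 * h%:Z - 1 + 4 * e) he hG => A he hG.
have [b eb] : exists b, jacobsthal g = 2 * b.
  have [b [->|eb]] := int_parity (jacobsthal g); first by exists b.
  have : 4 * (p%:Z - A ^+ 2 - b ^+ 2 - b) = 1.
    by move: sq; rewrite he eb => sq; rewrite !mulrBr -sq; clear; ring.
  by move: (_ - b) => z; lia.
have pA : p%:Z = A ^+ 2 + b ^+ 2.
  have four : 4 != 0 :> int by [].
  apply: (mulfI four); rewrite -sq he eb; clear; ring.
have sgE : (-1) ^+ h * (-1) ^+ h = 1 :> int by rewrite -expr2 sqrr_sign.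
have xE : - (-1) ^+ h * A = x.
  apply: (two_squares_unique pp (b := b) _ px _ hx).
    by rewrite exprMn sqrrN sqrr_sign mul1r.
  rewrite -signr_odd -AE; have := odd_double_half h; case: (odd h) => eh.
    by apply/dvdzP; exists (h./2%:Z + e); rewrite expr1; clear -eh; lia.
  by apply/dvdzP; exists (- h./2%:Z - e); rewrite expr0; clear -eh; lia.
rewrite (dvdz_pcharf (pchar_Fp pp)) -xE rmorphB /= subr_eq0.
rewrite mulrCA rmorphM /= hG rmorphN rmorphXn /= rmorphN /=.
by rewrite mulrNN mulrCA -expr2 sqrr_sign mulr1.
Qed.

(** * The three sums *)

Lemma odd_natr_neq0 (k : nat) : 2 * k%:R - 1 != 0 :> rat.
Proof.
rewrite subr_eq0 -natrM (eqr_nat _ _ 1); apply/eqP => e.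
by have := congr1 odd e; rewrite oddM.
Qed.

Lemma gbin_Nhalf_half (k : nat) :
  gbin (- (1 / 2)) k = (1 - 2 * k%:R) * gbin (1 / 2) k.
Proof.
rewrite gbin_half gbin_Nhalf; have := odd_natr_neq0 k.
rewrite -oppr_eq0 opprB => h; field.
by rewrite h expf_neq0.
Qed.

Lemma central_sqr_half (k : nat) :
  'C(2 * k, k)%:R ^+ 2 / ((- 16) ^+ k * (2 * k%:R - 1) ^+ 2)
  = (-1) ^+ k * gbin (1 / 2) k ^+ 2 :> rat.
Proof.
rewrite gbin_half (_ : -16 = -1 * (-4 * -4)); last by ring.
rewrite [(-1 * _) ^+ k]exprMn [(-4 * _) ^+ k]exprMn.
have h := odd_natr_neq0 k; have h' := h; rewrite -oppr_eq0 opprB in h'.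
have s : (-1) ^+ k * (-1) ^+ k = 1 :> rat by rewrite -expr2 sqrr_sign.
have s0 : (-1) ^+ k != 0 :> rat by rewrite signr_eq0.
have f0 : (-4) ^+ k != 0 :> rat by rewrite expf_neq0.
move: (_ ^+ k) (_ ^+ k) s s0 f0 => a b s a0 b0.
apply: (mulfI a0); rewrite [RHS]mulrA s; field.
by rewrite a0 b0 h h'.
Qed.

Lemma central_sqr_mixed (k : nat) :
  'C(2 * k, k)%:R ^+ 2 / ((- 16) ^+ k * (2 * k%:R - 1))
  = (-1) ^+ k * gbin (1 / 2) k ^+ 2 * (2 * k%:R - 1) :> rat.
Proof.
rewrite -central_sqr_half; have h := odd_natr_neq0 k; field.
by rewrite h expf_neq0.
Qed.

(* Telescopes t_k (8 k^2 - 4 k + 1), where t_k = (-1)^k binom(1/2, k)^2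
   satisfies 4 (k+1)^2 t_(k+1) = - (2k-1)^2 t_k. *)
Lemma contiguous_sum (K : nat) :
  2 * \sum_(k < K.+1) (-1) ^+ k * gbin (- (1 / 2)) k ^+ 2
  + 2 * \sum_(k < K.+1) (-1) ^+ k * gbin (1 / 2) k ^+ 2 * (2 * k%:R - 1)
  + \sum_(k < K.+1) (-1) ^+ k * gbin (1 / 2) k ^+ 2
  = (-1) ^+ K * gbin (- (1 / 2)) K ^+ 2 :> rat.
Proof.
rewrite !mulr_sumr -!big_split /=; elim: K => [|K IH].
  by rewrite big_ord_recr big_ord0 /= !gbin0; ring.
rewrite big_ord_recr IH /= !gbin_Nhalf_half gbinS [(-1) ^+ K.+1]exprS -natr1; field.
by rewrite nat1r pnatr_eq0.
Qed.

Lemma congr_fermat (p : nat) : prime p -> odd p ->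
  congr_Zp p p (2 ^+ p.-1) 1.
Proof.
move=> pp op; rewrite -[2]/(2%:~R) -rmorphXn /= -[1 in X in congr_Zp _ _ _ X]/(1%:~R).
apply: congr_int => //; rewrite (dvdz_pcharf (pchar_Fp pp)).
have two : 2 != 0 :> 'F_p by apply: two_neq0; rewrite card_Fp.
have := expf_card_pred two; rewrite card_Fp // => e.
by rewrite rmorphB rmorphXn /= subr_eq0 e.
Qed.

Lemma p_integral_inv_int (p : nat) (x : int) : ~~ (p %| x)%Z ->
  x%:~R^-1 \in p_integral p.
Proof.
move=> hx; apply/p_integralP; exists (sgz x), `|x|%N; first by rewrite dvdzE in hx.
have [->|x0] := eqVneq x 0; first by rewrite sgz0 mul0r invr0.
rewrite [in LHS](intEsg x) rmorphM /= invfM -pmulrn; congr (_ / _).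
by case: sgzP x0; rewrite ?eqxx ?invrN ?invr1.
Qed.

(** The integer on the right is (p^2+1)/2. *)
Lemma congr_half (p L : nat) : prime p -> p = L.*2.+1 ->
  congr_Zp p (p ^ 2) (1 / 2) (L.+1 + p * L)%N%:R.
Proof.
move=> pp pE; have h : 1 / 2 \in p_integral p.
  rewrite mul1r; apply: (p_integral_invn (k := 2)).
  by apply: contraL pp => /(@dvdn_leq p 2 isT); case: L pE => [|[|L]] -> .
split=> //; first exact: p_integral_nat.
exists (- (1 / 2)); first exact: p_integralN.
by rewrite natrX natrD natrM pE -!natr1 -muln2 natrM; field.
Qed.

Lemma congr_Nhalf (p L : nat) : prime p -> p = L.*2.+1 ->
  congr_Zp p (p ^ 2) (- (1 / 2)) (L + p * L)%N%:R.
Proof.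
move=> pp pE; have one : (1 : rat) \in p_integral p := p_integral_nat 1 pp.
have := congrB pp (congr_half pp pE) (congr_refl (p ^ 2) pp one).
rewrite (_ : (L.+1 + p * L)%:R - 1 = (L + p * L)%:R :> rat) => [h|]; last first.
  by rewrite addSn -natr1 addrK.
by rewrite (_ : - (1 / 2) = 1 / 2 - 1 :> rat); last by field.
Qed.

Lemma sum_gbin_sqr (p M : nat) (a : rat) : prime p ->
  congr_Zp p (p ^ 2) a M%:R ->
  congr_Zp p (p ^ 2) (\sum_(k < p) (-1) ^+ k * gbin a k ^+ 2)
    (\sum_(k < p) (-1) ^+ k * 'C(M, k)%:R ^+ 2).
Proof.
move=> pp ha; apply: congr_sum => // k _ _.
apply: congrMl; rewrite ?p_integral_sign //.
by apply: congrX => //; apply: congr_gbin.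
Qed.

(** The closed form of [sum_sqr_bin_odd] carries a factor p, so the rest is needed modulo p: 16^h =
    2^(p-1) is 1 by Fermat, 2(2h+1) = p+1 is 1, and binom(2h, h) is 2x by Gauss. *)
Lemma sum_half_1mod4 (p h : nat) (x y : int) : prime p -> p = (4 * h).+1 ->
  p%:Z = x ^+ 2 + 4 * y ^+ 2 -> (4 %| x - 1)%Z ->
  congr_Zp p (p ^ 2) (\sum_(k < p) (-1) ^+ k * gbin (1 / 2) k ^+ 2)
    ((-1) ^+ h * (p%:R / x%:~R)).
Proof.
move=> pp pE px hx; have pL : p = (h.*2).*2.+1 by lia.
have h0 : (0 < h)%N by case: h pE pp {pL} => // ->.
have hp : (h.*2.+1 < p)%N by lia.
apply: (congr_trans pp (sum_gbin_sqr pp (congr_half pp pL))).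
apply: (congr_trans pp (sum_sqr_bin_odd pp pL hp)).
have op : odd p by rewrite pE /= oddM.
have gauss := gauss_binomial pp pE px hx.
have G := congr_int pp gauss.
rewrite rmorphM /= -[_%:~R in X in congr_Zp _ _ X _]pmulrn in G.
have Gp : ~~ (p %| 'C(h.*2, h))%N by apply: ndvd_bin => //; lia.
have xp : ~~ (p %| x)%Z.
  apply: contra Gp => xp; have : (p%:Z %| 'C(h.*2, h)%:Z)%Z.
    by rewrite -(subrK (2 * x) 'C(h.*2, h)%:Z) rpredD // dvdz_mull.
  by rewrite dvdzE.
have x0 : x%:~R != 0 :> rat.
  by rewrite intr_eq0; apply: contra xp => /eqP ->; rewrite dvdz0.
have Gq : 'C(h.*2, h)%:R != 0 :> rat.
  by rewrite pnatr_eq0; apply: contra Gp => /eqP ->.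
rewrite mul2n [_ * (p%:R / _)]mulrCA; apply: congr_scale => //; rewrite -mulrA.
apply: congrMl; rewrite ?p_integral_sign //.
set D : rat := h.*2.+1%:R * 'C(h.*2, h)%:R * x%:~R.
have D0 : D != 0 by rewrite !mulf_neq0 // pnatr_eq0.
apply: (congr_cancel (u := D)) => //.
  rewrite !invfM p_integralM ?p_integralM ?p_integral_inv_int ?p_integral_invn //.
  by apply: ltn_prime_ndvd.
have -> : D * (16 ^+ h / (h.*2.+1%:R * 'C(h.*2, h)%:R)) = 16 ^+ h * x%:~R.
  have N0 : h.*2.+1%:R != 0 :> rat by rewrite pnatr_eq0.
  by rewrite /D; move: (h.*2.+1%:R : rat) N0 => N N0; field; rewrite Gq N0.
have -> : D / x%:~R = h.*2.+1%:R * 'C(h.*2, h)%:R by rewrite mulfK.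
have xi := p_integral_int x pp.
apply: (congr_trans (b := x%:~R)) => //.
  rewrite -[X in congr_Zp _ _ _ X]mul1r; apply: congrM => //; last exact: congr_refl.
  have := congr_fermat pp op; rewrite pE /= (_ : 16 = 2 ^+ 4) -?exprM //; ring.
apply: congr_sym; apply: (congr_trans (b := h.*2.+1%:R * (2 * x%:~R))) => //.
  by apply: congrMl => //; apply: p_integral_nat.
split=> //; first by rewrite !p_integralM // p_integral_nat.
exists x%:~R => //; rewrite pE -!natr1 -muln2 !natrM; ring.
Qed.

(** The sum reduces to e binom(1/2, h+1) with e = (-1)^(h+1), that is to 2G/(W(1-p)) with W =
    2^((p-1)/2) and G = binom((p-1)/2, h). Writing eW = 1 + pu turns the claim into a polynomial
    identity modulo p^2. *)
Lemma sum_half_3mod4 (p h : nat) : prime p -> p = (4 * h).+3 ->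
  congr_Zp p (p ^ 2) (\sum_(k < p) (-1) ^+ k * gbin (1 / 2) k ^+ 2)
    ((-1) ^+ h.+1 * (2 * p%:R + 3 - 2 ^+ (p - 1)%N) * 'C(h.*2.+1, h)%:R).
Proof.
move=> pp pE; set L := h.*2.+1; have pL : p = L.*2.+1 by rewrite /L; lia.
have half := congr_half pp pL.
have em : ~~ odd L.+1 by rewrite /= odd_double.
have mp : (L.+1 < p)%N by rewrite pL; lia.
have hp : (h.+1 < p)%N by lia.
have m2 : L.+1./2 = h.+1 by rewrite /L /= doubleK.
apply: (congr_trans pp (sum_gbin_sqr pp half)).
have := sum_sqr_bin_even L pp em mp; rewrite m2 => /(congr_trans pp); apply.
have c2 := congr_gbin pp hp half.
have cp := congr_weaken (k := p) (m := p) pp c2.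
have {}cp := congr_trans pp cp (congr_bin_addp L L.+1 pp hp).
set e : rat := (-1) ^+ h.+1.
have ei : e \in p_integral p by exact: p_integral_sign.
have ee : e * e = 1 by rewrite -expr2 sqrr_sign.
apply: (congr_trans (b := e * gbin (1 / 2) h.+1)) => //.
  by apply: congrMl => //; apply: congr_sym.
set G := 'C(L, h).
have G2 : 'C(L.+1, h.+1) = (2 * G)%N.
  rewrite binS (_ : 'C(L, h.+1) = G) ?addnn ?mul2n // /G -bin_sub; last first.
    by rewrite /L; lia.
  by congr 'C(_, _); rewrite /L; lia.
have Gp : ~~ (p %| G)%N by apply: ndvd_bin; rewrite // /L; lia.
have Gq : G%:R != 0 :> rat by rewrite pnatr_eq0; apply: contra Gp => /eqP ->.
set W : rat := 2 ^+ L.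
have W0 : W != 0 by rewrite expf_neq0.
have p1 : 1 - p%:R != 0 :> rat.
  rewrite subr_eq0 eq_sym pnatr_eq1.
  by case: p pp {pE pL half mp hp c2 cp ei Gp} => [|[]].
have gE : gbin (1 / 2) h.+1 = e * (2 * G%:R / (W * (1 - p%:R))).
  rewrite gbin_half (_ : 2 * h.+1 = L.+1)%N; last by rewrite /L; lia.
  rewrite G2 natrM -mulN1r exprMn -/e.
  have -> : 4 ^+ h.+1 = 2 * W :> rat.
    rewrite /W -exprS (_ : 4 = 2 ^+ 2) -?exprM; last by ring.
    by congr (_ ^+ _); rewrite /L; lia.
  have -> : 1 - 2 * h.+1%:R = (1 - p%:R) / 2 :> rat.
    by rewrite pE -!natr1 natrM; field.
  have e0 : e != 0 by rewrite signr_eq0.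
  apply: (mulfI e0); rewrite [RHS]mulrA ee; field.
  by rewrite e0 W0 p1.
have Wp : 2 ^+ (p - 1)%N = W ^+ 2 :> rat.
  by rewrite /W -exprM; congr (_ ^+ _); rewrite pE /L; lia.
have inat k : k%:R \in p_integral p by exact: p_integral_nat.
have Wi : W \in p_integral p by apply: p_integralX => //; apply: (inat 2%N).
have p1i : 1 - p%:R \in p_integral p.
  by rewrite p_integralD // ?p_integralN // (inat 1%N).
have two_p : ~~ (p %| 2)%N by rewrite ltn_prime_ndvd //; lia.
have Gi : G%:R^-1 \in p_integral p by exact: p_integral_invn.
(* The same evaluation modulo p only, giving (2/p) = (-1)^((p+1)/4). *)
have v1 : congr_Zp p p (e * W) 1.
  have h1 : congr_Zp p p 1 (e * W * (1 - p%:R)).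
    apply: (congr_cancel (u := 2 * G%:R)) => //; first by rewrite mulf_neq0.
      by rewrite invfM p_integralM // p_integral_invn.
    have := congrMl pp (p_integralM pp ei (p_integralM pp Wi p1i)) cp.
    rewrite G2 natrM gE (_ : e * (W * _) * (e * _) = (e * e) * (2 * G%:R)).
      2: by field; rewrite W0 p1.
    rewrite ee mul1r mulr1.
    rewrite (_ : 2 * G%:R * (e * W * _)
      = e * (W * (1 - p%:R)) * (2 * G%:R)) //.
    by ring.
  apply: (congr_trans pp _ (congr_sym h1)); split.
  - exact: p_integralM.
  - by rewrite !p_integralM.
  - by exists (e * W); [exact: p_integralM | ring].
rewrite gE mulrA ee mul1r Wp.
have [_ _ [u ui eu]] := v1.
have Wii : W^-1 \in p_integral p by rewrite -exprVn p_integralX // p_integral_invn.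
have p1ii : (1 - p%:R)^-1 \in p_integral p.
  have -> : 1 - p%:R = - (p.-1)%:R :> rat by rewrite pE -!natr1; ring.
  rewrite invrN p_integralN // p_integral_invn // ltn_prime_ndvd //.
  by rewrite pE /=; clear; lia.
apply: (congr_cancel (u := W * (1 - p%:R))) => //; first by rewrite mulf_neq0.
  by rewrite invfM p_integralM.
have -> : W * (1 - p%:R) * (2 * G%:R / (W * (1 - p%:R))) = 2 * G%:R.
  by field; rewrite W0 p1.
have -> : W * (1 - p%:R) * (e * (2 * p%:R + 3 - W ^+ 2) * G%:R)
    = (1 - p%:R) * (e * W) * (2 * p%:R + 3 - (e * W) ^+ 2) * G%:R.
  by rewrite exprMn [e ^+ 2]expr2 ee mul1r; ring.
have eW : e * W = 1 + p%:R * u by rewrite -eu addrC subrK.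
(* In (1-p)(1+pu)(2p+3-(1+pu)^2) the terms linear in p cancel and the constant is 2; [c] is the
   quotient by p^2 of what remains, times G. *)
rewrite eW; set c := (2 - (1 - p%:R) * (2 * u - 3 * u ^+ 2 - p%:R * u ^+ 3)) * G%:R.
have D (a b : rat) := @p_integralD p a b pp.
have M (a b : rat) := @p_integralM p a b pp.
have N (a : rat) := @p_integralN p a.
have X (a : rat) k := @p_integralX p a k pp.
have one : (1 : rat) \in p_integral p by exact: (inat 1%N).
split; last exists c.
- by apply: M; apply: inat.
- by rewrite !(M, D, N, X, inat).
- by rewrite !(M, D, N, X, inat).
- by rewrite /c natrX; ring.
Qed.

(** Again a factor p is explicit. Modulo p, 4 16^h = 2^(p-1) and 4(h+1) = p+1 are both 1, after
    (2h+1) binom(2h, h) is rewritten as (h+1) binom(2h+1, h). *)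
Lemma sum_Nhalf_3mod4 (p h : nat) : prime p -> p = (4 * h).+3 ->
  congr_Zp p (p ^ 2) (\sum_(k < p) (-1) ^+ k * gbin (- (1 / 2)) k ^+ 2)
    ((-1) ^+ h * (p%:R / 'C(h.*2.+1, h)%:R)).
Proof.
move=> pp pE; set L := h.*2.+1; have pL : p = L.*2.+1 by rewrite /L; lia.
have hp : (L < p)%N by rewrite pL; lia.
have op : odd p by rewrite pL /= odd_double.
apply: (congr_trans pp (sum_gbin_sqr pp (congr_Nhalf pp pL))).
apply: (congr_trans pp (sum_sqr_bin_odd pp pL hp)).
rewrite [_ * (p%:R / _)]mulrCA; apply: congr_scale => //; rewrite -mulrA.
apply: congrMl; rewrite ?p_integral_sign //.
have -> : h.*2.+1%:R * 'C(2 * h, h)%:R = h.+1%:R * 'C(L, h)%:R :> rat.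
  rewrite -!natrM; congr _%:R; rewrite mul2n (mul_bin_diag L h).
  congr (_ * _)%N; rewrite -bin_sub; last by rewrite /L; lia.
  by congr 'C(_, _); rewrite /L; lia.
have Gp : ~~ (p %| 'C(L, h))%N by apply: ndvd_bin; rewrite // /L; lia.
have Gq : 'C(L, h)%:R != 0 :> rat.
  by rewrite pnatr_eq0; apply: contra Gp => /eqP ->.
have two_p : ~~ (p %| 2)%N by rewrite ltn_prime_ndvd //; lia.
have h1p : ~~ (p %| h.+1)%N by rewrite ltn_prime_ndvd //; lia.
have h1 : h.+1%:R != 0 :> rat by rewrite pnatr_eq0.
apply: (congr_cancel (u := 2 * 2 * h.+1%:R * 'C(L, h)%:R)) => //.
- by rewrite !mulf_neq0.
- by rewrite !invfM !p_integralM // p_integral_invn.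
have -> : 2 * 2 * h.+1%:R * 'C(L, h)%:R * (16 ^+ h / (h.+1%:R * 'C(L, h)%:R))
    = 2 ^+ p.-1 :> rat.
  have -> : 2 ^+ p.-1 = 2 * 2 * 16 ^+ h :> rat.
    by rewrite pE /= 2!exprS mulrA exprM; congr (_ * _ ^+ _); ring.
  by move: (h.+1%:R : rat) h1 => z z0; field; rewrite Gq z0.
rewrite mulfK //; apply: (congr_trans pp (congr_fermat pp op)); split.
- exact: (p_integral_nat 1).
- by rewrite !p_integralM // p_integral_nat.
- exists (- 1); first exact: (p_integralN (p_integral_nat 1 pp)).
  by rewrite pE -!natr1 natrM; ring.
Qed.

Theorem theorem3p2 (p : nat) (p_prime : prime p) (p_odd : odd p) :
  ((p = 1 %[mod 4])%N ->
    forall x y : int,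
      p%:Z = x ^+ 2 + 4 * y ^+ 2 ->
      (4 %| x - 1)%Z ->
      congr_Zp p (p ^ 2)
        (\sum_(0 <= k < p)
           ('C(2 * k, k)%:R ^+ 2 / ((- 16) ^+ k * (2 * k%:R - 1) ^+ 2)))
        ((-1) ^+ ((p - 1) %/ 4)%N * (p%:R / x%:~R)))
  /\
  ((p = 3 %[mod 4])%N ->
    congr_Zp p (p ^ 2)
      (\sum_(0 <= k < p)
         ('C(2 * k, k)%:R ^+ 2 / ((- 16) ^+ k * (2 * k%:R - 1) ^+ 2)))
      ((-1) ^+ ((p + 1) %/ 4)%N * (2 * p%:R + 3 - 2 ^+ (p - 1)%N)
         * 'C((p - 1) %/ 2, (p - 3) %/ 4)%:R)
    /\
    congr_Zp p (p ^ 2)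
      (\sum_(0 <= k < p)
         ('C(2 * k, k)%:R ^+ 2 / ((- 16) ^+ k * (2 * k%:R - 1))))
      (1 / 2 * (-1) ^+ ((p - 3) %/ 4)%N * (2 * p%:R + 3 - 2 ^+ (p - 1)%N)
         * 'C((p - 1) %/ 2, (p - 3) %/ 4)%:R
       - (-1) ^+ ((p - 3) %/ 4)%N
         * (p%:R / 'C((p - 1) %/ 2, (p - 3) %/ 4)%:R))).
Proof.
have S2E : \sum_(0 <= k < p)
      ('C(2 * k, k)%:R ^+ 2 / ((- 16) ^+ k * (2 * k%:R - 1) ^+ 2))
    = \sum_(k < p) (-1) ^+ k * gbin (1 / 2) k ^+ 2 :> rat.
  by rewrite big_mkord; apply: eq_bigr => k _; exact: central_sqr_half.
split=> [p4 x y px hx|p4].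
  have pE : p = (4 * (p %/ 4)).+1 by rewrite {1}(divn_eq p 4) p4; lia.
  have -> : ((p - 1) %/ 4 = p %/ 4)%N by lia.
  by rewrite S2E; exact: (sum_half_1mod4 p_prime pE px hx).
set h := (p %/ 4)%N.
have pE : p = (4 * h).+3 by rewrite {1}(divn_eq p 4) p4 /h; lia.
have -> : ((p - 1) %/ 2 = h.*2.+1)%N by lia.
have -> : ((p - 3) %/ 4 = h)%N by lia.
have -> : ((p + 1) %/ 4 = h.+1)%N by lia.
have S2 := sum_half_3mod4 p_prime pE.
split; first by rewrite S2E.
have S0 := sum_Nhalf_3mod4 p_prime pE.
have := contiguous_sum p.-1; rewrite prednK ?prime_gt0 //.
set s0 := \sum_(k < p) _ in S0 *; set s2 := \sum_(k < p) _ in S2 *.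
have -> : \sum_(k < p) (-1) ^+ k * gbin (1 / 2) k ^+ 2 * (2 * k%:R - 1)
   = \sum_(0 <= k < p) ('C(2 * k, k)%:R ^+ 2 / ((- 16) ^+ k * (2 * k%:R - 1))) :> rat.
  by rewrite big_mkord; apply: eq_bigr => k _; rewrite central_sqr_mixed.
set s1 := \sum_(0 <= k < p) _; set d := gbin _ _ => e.
have pL : p = (h.*2.+1).*2.+1 by lia.
(* The boundary term of the telescoped relation is, up to sign, the square of [d]. Modulo p, [d] is
   binom((p-1)/2, p-1) = 0, so the square vanishes modulo p^2. *)
have d0 : congr_Zp p p d 0.
  have pp1 : (p.-1 < p)%N by rewrite prednK ?prime_gt0.
  have c := congr_gbin p_prime pp1 (congr_Nhalf p_prime pL).
  have {}c := congr_weaken (k := p) (m := p) p_prime c.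
  have := congr_trans p_prime c (congr_bin_addp h.*2.+1 h.*2.+1 p_prime pp1).
  by rewrite bin_small //; lia.
have dd : congr_Zp p (p ^ 2) (d * d) 0.
  by have := congr_mul_sub p_prime d0 d0; rewrite mulr0 mul0r addr0 subr0.
have -> : s1 = 1 / 2 * ((-1) ^+ p.-1 * (d * d)) - 1 / 2 * s2 - s0.
  by rewrite -expr2 -e; field.
(* A zero boundary term is inserted and (-1)^h is written as -(-1)^(h+1), so that both sides match
   term by term. *)
have -> : 1 / 2 * (-1) ^+ h * (2 * p%:R + 3 - 2 ^+ (p - 1)%N) * 'C(h.*2.+1, h)%:R
    = 1 / 2 * ((-1) ^+ p.-1 * 0) - 1 / 2 * ((-1) ^+ h.+1
      * (2 * p%:R + 3 - 2 ^+ (p - 1)%N) * 'C(h.*2.+1, h)%:R) :> rat.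
  by rewrite exprS; ring.
have [half_int _ _] := congr_half p_prime pL.
apply: congrB => //; apply: congrB => //; apply: congrMl => //.
by apply: congrMl => //; exact: p_integral_sign.
Qed.
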